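(* There exists a constant $c_->0$ such that, for every even $k\geq 4$, if $T$ is a perfect $k$-ary tree and $\xi_0\in\{-1,1\}^{V(T)}$ is chosen uniformly at random, then with probability tending to $1$ as the diameter $D(T)\to\infty$, $$c_-\cdot\frac{\sqrt{\ln k}}{k}\sqrt{D(T)}<\tau(T;\xi_0)\leq D(T)-3.$$
   Context: A rooted tree is $k$-ary if every non-leaf vertex (including the root) has exactly $k+1$ neighbours; so the root has $k+1$ children and every other non-leaf vertex has $k$ children. It is perfect if all leaves are at the same distance from the root. Majority dynamics on a graph $G$ with all degrees odd: given $\xi_0\in\{-1,1\}^{V(G)}$, for $t\ge1$, $\xi_t(i)=\mathrm{sign}\sum_{j\in N_G(i)}\xi_{t-1}(j)$. The stabilisation time is $\tau(G;\xi_0)=\min\{t\ge0:\ \xi_{t+2}(i)=\xi_t(i)\text{ for all } i\in V(G)\}$. *)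

(* Defs.v *)
From HB Require Import structures.
From mathcomp Require Import all_boot all_order all_algebra zify lra.
From mathcomp Require Import all_classical all_reals all_analysis.

Set Implicit Arguments.
Unset Strict Implicit.
Unset Printing Implicit Defensive.

Import Order.TTheory GRing.Theory Num.Theory.

Local Open Scope ring_scope.

Record sgraph := SGraph {
  vertex :> finType;
  edge : rel vertex;
  edge_sym : symmetric edge;
  edge_irr : irreflexive edge
}.

Definition degree (G : sgraph) (x : G) : nat := #|[set y | edge x y]|.

(* The length of a shortest walk from x to y. The search stops at #|G|, which
   is larger than every distance in a connected graph. *)
Definition dist (G : sgraph) (x y : G) : nat :=
  find (fun n => [exists p : n.-tuple G,
                    path (@edge G) x p && (last x p == y)])
       (iota 0 #|G|).

Definition diameter (G : sgraph) : nat := (\max_(x : G) \max_(y : G) dist x y)%N.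

(* ucycle also accepts the empty sequence and, for every edge xy, the sequence
   [:: x; y]; the cycles of a simple graph are those of size at least 3. *)
Definition is_tree (G : sgraph) : Prop :=
  (forall x y : G, connect (@edge G) x y) /\
  (forall c : seq G, ucycle (@edge G) c -> (size c <= 2)%N).

Definition leaf (G : sgraph) (r x : G) : bool := (x != r) && (degree x == 1%N).

Definition perfect_kary_tree (k : nat) (G : sgraph) (r : G) : Prop :=
  [/\ is_tree G,
      forall x : G, ~~ leaf r x -> degree x = k.+1 &
      forall x y : G, leaf r x -> leaf r y -> dist r x = dist r y].

(* An element of {-1,1}^V is coded by a Boolean function on V, so that the
   initial conditions form a finite type. *)
Definition spins (G : sgraph) (s : {ffun G -> bool}) : G -> int :=
  fun i => if s i then 1 else -1.

(* If all degrees are odd, the sum is odd on {-1,1}-valued functions, so the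
   value Num.sg 0 = 0 does not occur. *)
Definition majority (G : sgraph) (xi : G -> int) : G -> int :=
  fun i => Num.sg (\sum_(j | edge i j) xi j).

Definition dynamics (G : sgraph) (s : {ffun G -> bool}) (t : nat) : G -> int :=
  iter t (@majority G) (spins s).

Definition periodic_from (G : sgraph) (s : {ffun G -> bool}) (t : nat) : bool :=
  [forall i : G, dynamics s t.+2 i == dynamics s t i].

Section Stabilisation.
Variables (G : sgraph) (s : {ffun G -> bool}).

Let x := dynamics s.
Let S t i := \sum_(j | edge i j) x t j.

Let xS t i : x t.+1 i = Num.sg (S t i).
Proof. by []. Qed.

Let x_spec t i : [\/ x t i = -1, x t i = 0 | x t i = 1].
Proof.
case: t => [|t]; last first.
  by rewrite xS; case: sgrP => _; [apply: Or32|apply: Or33|apply: Or31].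
by rewrite /x /dynamics /= /spins; case: ifP => _; [apply: Or33|apply: Or31].
Qed.

Let step_ineq (a b : int) : [\/ a = -1, a = 0 | a = 1] ->
  (Num.sg b != a)%:Z <= 2 * ((Num.sg b - a) * b) - (Num.sg b ^+ 2 - a ^+ 2).
Proof. by move=> [] ->; case: sgrP => hb; rewrite ?expr2 /=; lia. Qed.

Let F t := \sum_i (2 * (x t.+1 i * S t i) - x t i ^+ 2 - x t.+1 i ^+ 2).

Let energy_sym t :
  \sum_i x t.+1 i * S t i = \sum_i x t i * S t.+1 i.
Proof.
have E (u v : nat) : \sum_i x u i * S v i
     = \sum_i \sum_j (if edge i j then x u i * x v j else 0).
  by apply: eq_bigr => i _; rewrite mulr_sumr big_mkcond.
rewrite !E exchange_big; apply: eq_bigr => i _; apply: eq_bigr => j _.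
by rewrite edge_sym mulrC.
Qed.

Let F_step t : ~~ periodic_from s t -> F t + 1 <= F t.+1.
Proof.
move=> nst.
have -> : F t.+1 = F t + \sum_i (2 * ((x t.+2 i - x t i) * S t.+1 i)
                                 - (x t.+2 i ^+ 2 - x t i ^+ 2)).
  have : \sum_i 2 * (x t.+1 i * S t i) = \sum_i 2 * (x t i * S t.+1 i).
    by rewrite -!mulr_sumr energy_sym.
  rewrite /F; under [X in _ -> X = _]eq_bigr do rewrite -addrA.
  under [X in _ -> _ = X + _]eq_bigr do rewrite -addrA.
  rewrite [X in _ -> _ = X + _]big_split /= => ->.
  rewrite -!big_split /=; apply: eq_bigr => i _; lia.
rewrite lerD2l.
apply: (@le_trans _ _ (\sum_i (x t.+2 i != x t i)%:Z)).
  move: nst => /forallPn[i ne]; rewrite (bigD1 i) //= ne.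
  by rewrite lerDl sumr_ge0.
by apply: ler_sum => i _; apply: step_ineq; exact: x_spec.
Qed.

Let F_bound t : F t <= \sum_(i : G) 2 * \sum_(j | edge i j) 1.
Proof.
apply: ler_sum => i _.
have h : `|S t i| <= \sum_(j | edge i j) 1.
  apply: le_trans (ler_norm_sum _ _ _) _; apply: ler_sum => j _.
  by case: (x_spec t j) => ->.
have := x_spec t.+1 i; have := x_spec t i.
move: h; set B := \sum_(j | _) 1 => h.
by move=> [] -> [] ->; rewrite ?expr2; lia.
Qed.

Lemma periodic_exists : exists t, periodic_from s t.
Proof.
apply: contrapT => nex.
have nst t : ~~ periodic_from s t by apply/negP => h; apply: nex; exists t.
have Fge t : F 0%N + t%:Z <= F t.
  elim: t => [|t IH]; first by rewrite addr0.
  by have := F_step (nst t); lia.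
set B := \sum_(i : G) 2 * \sum_(j | edge i j) (1 : int).
have h := Fge `|B - F 0%N|.+1.
have : F `|B - F 0%N|.+1 <= B := F_bound _.
lia.
Qed.

End Stabilisation.

Definition stabilisation_time (G : sgraph) (s : {ffun G -> bool}) : nat :=
  ex_minn (periodic_exists s).

Definition unif_fin_prob (R : realType) (T : finType) (E : pred T) : R :=
  #|E|%:R / #|T|%:R.

(* Main.v *)
(** Upper bound.  If a vertex changes from [-b] to [b] between times [t] and
    [t + 2], then some neighbour makes the same change between [t - 1] and
    [t + 1].  Going back in time, these vertices form a walk, which cannot
    backtrack because a vertex that has just become [b] is not about to become
    [b].  In a tree of height [h] such a walk climbs and then descends; it avoids
    the two lowest levels, since the parents of leaves never change, so it has
    at most [2 (h - 2) = D - 4] steps.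

    Lower bound.  Let a path [v_0, ..., v_L] descend from [v_0], and let its
    interior vertices be balanced: their off-path children keep constant signs
    of sum [1].  If [v_0] is positive for ever and the other [v_i] start
    negative, then the positive front moves down the path by one edge per step.
    A vertex keeps its sign up to time [L] as soon as its [k] children would do
    so while it is frozen; by symmetry and monotonicity each child has the right
    sign at each time with probability at least [1/2], so by Harris' inequality
    the vertex keeps its sign with probability at least [2^-(1 + k (L + 1))].
    Hence the path behaves as described with probability [2^-O(k^2 L^2)].  The
    events attached to disjoint subtrees are independent, and there are
    [k^(h - L - 1)] of these, which allows [L] of order [sqrt (h ln k) / k]. *)

Require Import Defs.
From mathcomp Require Import all_classical all_reals all_analysis.
From mathcomp Require Import all_boot all_order all_algebra zify ring lra.

Set Implicit Arguments.
Unset Strict Implicit.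
Unset Printing Implicit Defensive.

Import Order.TTheory GRing.Theory Num.Theory.

Local Open Scope ring_scope.

(** * Distances and descendants in a tree *)

Section Distance.
Variable G : sgraph.
Hypothesis G_connected : forall x y : G, connect (@edge G) x y.

Lemma dist_min (x y : G) p :
  path (@edge G) x p -> last x p = y -> (dist x y <= size p)%N.
Proof.
move=> pp lp; rewrite /dist; set a := (X in find X _).
case: (ltnP (size p) #|G|) => hs; last first.
  by apply: leq_trans hs; rewrite -[X in (_ <= X)%N](size_iota 0) find_size.
rewrite leqNgt; apply/negP => /(before_find 0%N).
rewrite nth_iota // add0n => /negbT/existsPn/(_ (in_tuple p)).
by rewrite /= pp lp eqxx.
Qed.

Lemma dist_path (x y : G) :
  exists p, [/\ path (@edge G) x p, last x p = y & size p = dist x y].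
Proof.
have /connectP[p0 pp0 lp0] := G_connected x y.
case/shortenP: pp0 lp0 => p pp up _ lp.
have hs : (size p < #|G|)%N by have := max_card (mem (x :: p)); rewrite (card_uniqP up).
rewrite /dist; set a := (X in find X _).
have ha : has a (iota 0 #|G|).
  apply/hasP; exists (size p); first by rewrite mem_iota.
  by apply/existsP; exists (in_tuple p); rewrite /= pp -lp eqxx.
have := nth_find 0%N ha; rewrite nth_iota; last first.
  by move: ha; rewrite has_find size_iota.
rewrite add0n => /existsP[q /andP[pq /eqP lq]].
by exists q; split => //; rewrite size_tuple.
Qed.

Lemma distxx (x : G) : dist x x = 0%N.
Proof. by apply/eqP; rewrite -leqn0; apply: (@dist_min x x [::]). Qed.

Lemma dist_edge (z x y : G) : edge x y -> (dist z y <= (dist z x).+1)%N.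
Proof.
move=> xy; have [p [pp lp <-]] := dist_path z x.
rewrite -(size_rcons p y); apply: dist_min; last by rewrite last_rcons.
by rewrite rcons_path pp lp.
Qed.

Lemma dist_eq0 (x y : G) : dist x y = 0%N -> x = y.
Proof. by have [[|a p] [_ <- <-]] := dist_path x y. Qed.

Lemma dist_pred (z x : G) : x != z ->
  exists2 y, edge x y & (dist z y).+1 = dist z x.
Proof.
move=> xz; have [p [pp lp sp]] := dist_path z x.
case/lastP: p pp lp sp => [|p a]; first by move=> _ zx; rewrite -zx eqxx in xz.
rewrite rcons_path last_rcons size_rcons => /andP[pp ea] ax; subst a => sp.
exists (last z p); first by rewrite edge_sym.
apply/eqP; rewrite eqn_leq [X in _ && X]dist_edge // -sp andbT.
by rewrite ltnS dist_min.
Qed.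

(** The vertex [z] moves along a shortest path to [x]: each step lowers the distance to [x] by one
    and raises the distance to [y] by at most one. *)
Lemma dist_triangle (z x y : G) : (dist x y <= dist z x + dist z y)%N.
Proof.
have [n] := ubnP (dist z x); elim: n z => // n IH z hz.
have [-> | zx] := eqVneq x z; first by rewrite distxx.
have [[|a p] [pp lp sp]] := dist_path z x; first by rewrite -lp eqxx in zx.
move: pp => /= /andP[za pp].
have hax : (dist a x <= size p)%N by apply: dist_min.
have haz : (dist a y <= (dist z y).+1)%N.
  have [q [qq lq <-]] := dist_path z y.
  by apply: (@dist_min _ _ (z :: q)) => //=; rewrite edge_sym za.
have := IH a; rewrite -sp /= in hz *; lia.
Qed.

End Distance.

(** * Parents, children and descendants in a rooted tree *)

Section Tree.
Variables (G : sgraph) (r : G).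
Hypothesis treeG : is_tree G.
Let conG := treeG.1.

Local Notation depth := (dist r).

Let e' (x : G) := [rel a b : G | [&& edge a b, a != x & b != x]].

(** A shortest path to the root strictly loses depth at each step, so it never meets [x], which is
    at least as deep as its start. *)
Let avoid_root (x y : G) : (depth y <= depth x)%N -> y != x -> connect (e' x) y r.
Proof.
have [n] := ubnP (depth y); elim: n y => // n IH y hn yx ne.
have [->|yr] := eqVneq y r; first exact: connect0.
have [z yz hz] := dist_pred conG yr.
have zx : z != x by apply/eqP => zx; move: yx; rewrite -hz zx ltnn.
apply: (connect_trans (y := z)); first by apply: connect1; rewrite /= yz ne.
by apply: IH => //; lia.
Qed.

(* Two such neighbours are joined through [r] while avoiding [x], which closes
   a cycle at [x]. *)
Lemma below_unique (x y z : G) : edge x y -> edge x z ->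
  (depth y <= depth x)%N -> (depth z <= depth x)%N -> y = z.
Proof.
move=> xy xz hy hz; apply/eqP; apply: contraT => yz.
have ny : y != x by apply/eqP => E; rewrite E edge_irr in xy.
have nz : z != x by apply/eqP => E; rewrite E edge_irr in xz.
have e'_sym : connect_sym (e' x).
  apply: sym_connect_sym => a b /=; rewrite edge_sym.
  by congr andb; rewrite andbC.
have : connect (e' x) y z.
  apply: (connect_trans (avoid_root hy ny)); rewrite e'_sym.
  exact: avoid_root.
case/connectP => p0 pp0 lp0.
case/shortenP: pp0 lp0 => p pp up _ lp.
have pe : path (@edge G) y p by apply: sub_path pp => a b /= /and3P[].
have xp : x \notin p.
  move: pp; elim: p (y) {up lp pe} => //= a p IH b /andP[/and3P[_ _ ax] /IH].
  by rewrite inE negb_or eq_sym ax.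
have /treeG.2 : ucycle (@edge G) [:: x, y & p].
  rewrite /ucycle /= in_cons negb_or eq_sym ny xp.
  by rewrite rcons_path xy pe -lp edge_sym xz.
case: p lp {pp up pe xp} => //= E; by rewrite E eqxx in yz.
Qed.

(** Equal depths are impossible: [y] and the predecessor of [x] on a shortest path from [r] would be
    two neighbours of [x] that are not deeper than [x]. *)
Lemma edge_depth (x y : G) : edge x y ->
  depth y = (depth x).+1 \/ depth x = (depth y).+1.
Proof.
move=> xy.
have h1 : (depth y <= (depth x).+1)%N by exact: dist_edge.
have h2 : (depth x <= (depth y).+1)%N by apply: dist_edge; rewrite // edge_sym.
suff : depth x <> depth y by lia.
move=> E; have [xr|xr] := eqVneq x r.
  have yr : r = y by apply: (dist_eq0 conG); rewrite -E xr distxx.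
  by rewrite -yr xr edge_irr in xy.
have [z xz hz] := dist_pred conG xr.
have zy : z = y by apply: (below_unique xz xy); lia.
by rewrite zy in hz; lia.
Qed.

(** No neighbour of the root is shallower, so the default makes the root its own parent. *)
Definition par (x : G) : G := odflt r [pick y | edge x y && (depth y < depth x)%N].

Lemma parP (x : G) : x != r -> edge x (par x) /\ depth x = (depth (par x)).+1.
Proof.
move=> xr; rewrite /par; case: pickP => [y /andP[xy hy]|h] /=.
  by split=> //; case: (edge_depth xy) => //; lia.
have [z xz hz] := dist_pred conG xr.
by have := h z; rewrite xz -hz ltnS leqnn.
Qed.

Lemma par_unique (x y : G) : edge x y -> depth x = (depth y).+1 -> par x = y.
Proof.
move=> xy hxy; have xr : x != r by apply/eqP => E; rewrite E distxx in hxy.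
have [xp hp] := parP xr; by apply: (below_unique xp xy); lia.
Qed.

Definition children (x : G) : {set G} := [set y | edge x y & depth y == (depth x).+1].

Lemma childP (x y : G) : reflect (par y = x /\ y != r) (y \in children x).
Proof.
rewrite inE; apply: (iffP andP) => [[xy /eqP h]|[<- yr]].
  split; first by apply: par_unique; rewrite // edge_sym.
  by apply/eqP => E; rewrite E distxx in h.
by have [e <-] := parP yr; rewrite edge_sym e.
Qed.

Lemma child_edge (x y : G) : y \in children x -> edge x y.
Proof. by rewrite inE => /andP[]. Qed.

Lemma child_depth (x y : G) : y \in children x -> depth y = (depth x).+1.
Proof. by rewrite inE => /andP[_ /eqP]. Qed.

Lemma edge_par_child (x y : G) : edge x y -> y = par x \/ y \in children x.
Proof.
move=> xy; case: (edge_depth xy) => h; first by right; rewrite inE xy h eqxx.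
by left; rewrite (par_unique xy h).
Qed.

Lemma edge_in_children (x y : G) : x != r ->
  edge x y = (y == par x) || (y \in children x).
Proof.
move=> xr; apply/idP/orP => [/edge_par_child[->|]|[/eqP ->|/child_edge //]].
- by left.
- by right.
- by have [] := parP xr.
Qed.

Lemma par_notin_children (x : G) : x != r -> par x \notin children x.
Proof.
by move=> xr; have [_ h] := parP xr; apply/negP => /child_depth; lia.
Qed.

Lemma sum_neighbours (f : G -> int) (x : G) : x != r ->
  \sum_(y | edge x y) f y = f (par x) + \sum_(y in children x) f y.
Proof.
move=> xr; rewrite (bigD1 (par x)) /=; last by have [] := parP xr.
congr (_ + _); apply: eq_bigl => y; rewrite edge_in_children //.
have [->|] := eqVneq y (par x); last by rewrite andbT.
by rewrite (negbTE (par_notin_children xr)).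
Qed.

(** The depths fix the number of applications of [par], so a vertex has at most one ancestor at each
    depth; disjointness of subtrees follows. *)
Definition desc (x y : G) : bool :=
  (depth x <= depth y)%N && (iter (depth y - depth x) par y == x).

Lemma desc_refl (x : G) : desc x x.
Proof. by rewrite /desc leqnn subnn /= eqxx. Qed.

Lemma desc_child (x y z : G) : desc x y -> z \in children y -> desc x z.
Proof.
move=> /andP[h /eqP E] zc; rewrite /desc (child_depth zc) (leq_trans h) //=.
by rewrite subSn // iterSr; have /childP[-> _] := zc; rewrite E eqxx.
Qed.

Lemma desc_par (x y : G) : desc x y -> y != x -> desc x (par y).
Proof.
move=> /andP[h /eqP E] yx.
have [yr|yr] := eqVneq y r.
  move: h; rewrite yr distxx leqn0 => /eqP/(dist_eq0 conG) rx.
  by rewrite yr rx eqxx in yx.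
have [_ hy] := parP yr.
move: h; rewrite leq_eqVlt => /orP[/eqP hxy|h].
  by move: E; rewrite hxy subnn /= => E; rewrite E eqxx in yx.
rewrite /desc; move: h E; rewrite hy ltnS => h.
by rewrite subSn // iterSr h => ->; rewrite eqxx.
Qed.

(** The subtree below [x] can be left only through [x] itself. Freezing [x] therefore makes the
    dynamics inside the subtree local. *)
Lemma desc_edge (x y z : G) : desc x y -> y != x -> edge y z -> desc x z.
Proof.
move=> d ne /edge_par_child[->|]; first exact: desc_par.
exact: desc_child.
Qed.

Lemma desc_disjoint (x y z : G) :
  depth x = depth y -> desc x z -> desc y z -> x = y.
Proof. by move=> h /andP[_ /eqP <-] /andP[_ /eqP <-]; rewrite h. Qed.

Lemma desc_trans (x y z : G) : desc x y -> desc y z -> desc x z.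
Proof.
move=> /andP[h1 /eqP E1] /andP[h2 /eqP E2].
rewrite /desc (leq_trans h1 h2) /=.
have -> : (depth z - depth x = depth y - depth x + (depth z - depth y))%N by lia.
by rewrite iterD E2 E1 eqxx.
Qed.

End Tree.

(** * Levels, degrees and diameter of a perfect [k]-ary tree *)

Section PerfectTree.
Variables (k : nat) (G : sgraph) (r : G).
Hypothesis k_ge2 : (2 <= k)%N.
Hypothesis perfG : perfect_kary_tree k r.
Let treeG : is_tree G. Proof. by case: perfG. Qed.
Let conG := treeG.1.

Local Notation depth := (dist r).

Definition height (H : sgraph) (x : H) : nat := (\max_(y : H) dist x y)%N.

Local Notation h := (height r).

Lemma depth_le_height (x : G) : (depth x <= h)%N.
Proof. exact: (bigop.leq_bigmax (F := fun y : G => dist r y)). Qed.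

Lemma degree_root : degree r = k.+1.
Proof. by case: perfG => _ H _; apply: H; rewrite /leaf eqxx. Qed.

Lemma degree_children (x : G) : x != r -> degree x = #|children r x|.+1.
Proof.
move=> xr; rewrite /degree.
have -> : [set y | edge x y] = par r x |: children r x.
  by apply/setP => y; rewrite in_set (edge_in_children treeG _ xr) in_setU1.
by rewrite cardsU1 (par_notin_children treeG xr).
Qed.

Lemma degree_children_root : degree r = #|children r r|.
Proof.
rewrite /degree; apply: eq_card => y; rewrite !inE distxx.
case E : (edge r y) => //=; by have [->|] := edge_depth r treeG E; rewrite distxx.
Qed.

Lemma children_bottom (x : G) : depth x = h -> children r x = finset.set0.
Proof.
move=> hx; apply/setP => y; rewrite in_set0; apply/negP => /child_depth hy.
by have := depth_le_height y; rewrite hy hx ltnn.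
Qed.

Lemma height_attained : exists x : G, depth x = h.
Proof.
have cG : (0 < #|G|)%N by apply/card_gt0P; exists r.
by have [x hx] := bigop.eq_bigmax (fun y : G => depth y) cG; exists x.
Qed.

Lemma bottom_neq_root (x : G) : depth x = h -> x != r.
Proof.
move=> hx; apply/eqP => E; have := degree_children_root.
by rewrite E in hx; rewrite degree_root (children_bottom hx) cards0.
Qed.

Lemma bottom_leaf (x : G) : depth x = h -> leaf r x.
Proof.
move=> hx; have xr := bottom_neq_root hx.
by rewrite /leaf xr degree_children // children_bottom // cards0.
Qed.

(** Vertices at maximal depth are leaves and all leaves have the same depth, so no vertex above the
    bottom level is a leaf. *)
Lemma degree_inner (x : G) : (depth x < h)%N -> degree x = k.+1.
Proof.
case: perfG => _ H1 H2 hx; apply: H1; apply/negP => lx.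
have [z hz] := height_attained.
by move: hx; rewrite (H2 x z lx (bottom_leaf hz)) hz ltnn.
Qed.

Lemma card_children (x : G) : x != r -> (depth x < h)%N -> #|children r x| = k.
Proof.
by move=> xr hx; have := degree_children xr; rewrite degree_inner // => -[].
Qed.

Lemma card_children_root : #|children r r| = k.+1.
Proof. by rewrite -degree_children_root degree_root. Qed.

Lemma card_children_ge (x : G) : (depth x < h)%N -> (k <= #|children r x|)%N.
Proof.
by have [->|xr] := eqVneq x r; rewrite ?card_children_root // => /card_children ->.
Qed.

Lemma degree_bottom (x : G) : depth x = h -> degree x = 1%N.
Proof. by move=> /bottom_leaf/andP[_ /eqP]. Qed.

Lemma degree_odd : ~~ odd k -> forall x : G, odd (degree x).
Proof.
move=> ek x; have := depth_le_height x; rewrite leq_eqVlt => /orP[/eqP|] hx.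
  by rewrite degree_bottom.
by rewrite degree_inner //= ek.
Qed.

Lemma card_level (d : nat) : (d <= h)%N ->
  (k ^ d <= #|[set x : G | depth x == d]|)%N.
Proof.
elim: d => [|d IH] hd.
  by rewrite expn0; apply/card_gt0P; exists r; rewrite inE distxx.
rewrite expnSr; apply: leq_trans (leq_mul (IH (ltnW hd)) (leqnn k)) _.
rewrite -[X in (_ <= X)%N]sum1_card (partition_big (par r) [in [set x : G | depth x == d]]) /=.
  rewrite -sum_nat_const; apply: leq_sum => x; rewrite inE => /eqP hx.
  have hx' : (depth x < h)%N by rewrite hx.
  apply: leq_trans (card_children_ge hx') _.
  rewrite sum1_card; apply: subset_leq_card; apply/fintype.subsetP => y yx.
  rewrite unfold_in /= in_set (child_depth yx) hx eqxx /=.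
  by have /(childP r treeG)[-> _] := yx; rewrite eqxx.
move=> y; rewrite !inE => /eqP hy.
have yr : y != r by apply/eqP => E; rewrite E distxx in hy.
by have [_] := parP treeG yr; rewrite hy => -[<-].
Qed.

Lemma desc_bottom (x : G) : exists2 y, desc r x y & depth y = h.
Proof.
have [n] := ubnP (h - depth x)%N; elim: n x => // n IH x hn.
have := depth_le_height x; rewrite leq_eqVlt => /orP[/eqP hx|hx].
  by exists x => //; exact: desc_refl.
have : (0 < #|children r x|)%N by have := card_children_ge hx; lia.
case/card_gt0P => y yx; have hy := child_depth yx.
have [|z dz hz] := IH y; first by rewrite hy; lia.
exists z => //; apply: desc_trans dz.
exact: (desc_child treeG (desc_refl r x)).
Qed.

Lemma diameter_le : (diameter G <= h.*2)%N.
Proof.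
apply/bigmax_leqP => x _; apply/bigmax_leqP => y _.
apply: leq_trans (dist_triangle conG r x y) _.
by rewrite -addnn leq_add // depth_le_height.
Qed.

(* The signed depth, positive below the child [c] of the root and negative
   elsewhere, changes by at most one along an edge. *)
Lemma diameter_ge : (h.*2 <= diameter G)%N.
Proof.
have : (1 < #|children r r|)%N by rewrite card_children_root; lia.
case/card_gt1P => c [c' [cr c'r cc']].
have [a da ha] := desc_bottom c; have [b db hb] := desc_bottom c'.
have hc := child_depth cr; have hc' := child_depth c'r.
have dcb : ~~ desc r c b.
  apply/negP => dcb; move/eqP: cc'; apply.
  by apply: (desc_disjoint _ dcb db); rewrite hc hc'.
pose phi y : int := if desc r c y then (depth y)%:Z else - (depth y)%:Z.
have phi_edge y z : edge y z -> phi y <= phi z + 1.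
  move=> yz; rewrite /phi; have hyz := edge_depth r treeG yz.
  have zy : edge z y by rewrite edge_sym.
  case dy : (desc r c y); case dz : (desc r c z); try lia.
  have [E|ne] := eqVneq y c; last first.
    by rewrite (desc_edge treeG dy ne yz) in dz.
  rewrite E in yz *; have [->|zc] := edge_par_child r treeG yz.
    by have /(childP r treeG)[-> _] := cr; rewrite distxx hc distxx.
  by rewrite (desc_child treeG (desc_refl r c) zc) in dz.
have phi_path y p : path (@edge G) y p -> phi y <= phi (last y p) + (size p)%:Z.
  elim: p y => [|z p IH] y /=; first by rewrite addr0.
  by move=> /andP[/phi_edge yz /IH]; lia.
have [p [pp lp sp]] := dist_path conG a b.
have := phi_path a p pp; rewrite lp sp /phi da (negbTE dcb) ha hb => hab.
have : (dist a b <= diameter G)%N.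
  apply: leq_trans (bigop.leq_bigmax (F := fun x => \max_y dist x y)%N a).
  exact: (bigop.leq_bigmax (F := fun y => dist a y)).
lia.
Qed.

Lemma diameterE : diameter G = h.*2.
Proof. by apply/eqP; rewrite eqn_leq diameter_le diameter_ge. Qed.

End PerfectTree.

(** * Uniform measure on configurations *)

Section UniformMeasure.
Variables (R : realType) (V : finType).
Local Notation config := {ffun V -> bool}.
Local Notation pr := (@unif_fin_prob R config).

Let N : R := #|{: config}|%:R.

Let N_gt0 : 0 < N.
Proof. by rewrite ltr0n; apply/card_gt0P; exists [ffun=> true]. Qed.

Let prE (E : pred config) : pr E * N = \sum_(s : config) (E s)%:R.
Proof.
rewrite /unif_fin_prob divfK ?gt_eqF //.
rewrite -sum1_card natr_sum big_mkcond; apply: eq_bigr => s _.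
by rewrite unfold_in; case: (E s).
Qed.

Lemma pr_ext (E F : pred config) : E =1 F -> pr E = pr F.
Proof. by move=> EF; rewrite /unif_fin_prob (eq_card EF). Qed.

Lemma pr_ge0 (E : pred config) : 0 <= pr E.
Proof. by rewrite /unif_fin_prob divr_ge0 ?ler0n. Qed.

Lemma pr_le (E F : pred config) : (forall s, E s -> F s) -> pr E <= pr F.
Proof.
move=> EF; rewrite /unif_fin_prob ler_pM2r ?invr_gt0 // ler_nat.
by apply: subset_leq_card; apply/fintype.subsetP => s; exact: EF.
Qed.


Lemma pr_true : pr (fun=> true) = 1.
Proof.
have N0 : N != 0 by rewrite gt_eqF.
by apply: (mulIf N0); rewrite prE mul1r sumr_const.
Qed.

Lemma prC (E : pred config) : pr (fun s => ~~ E s) = 1 - pr E.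
Proof.
have N0 : N != 0 by rewrite gt_eqF.
apply: (mulIf N0); rewrite mulrBl -pr_true !prE -sumrB.
by apply: eq_bigr => s _; case: (E s); rewrite ?subrr ?subr0.
Qed.

Lemma pr_bij (g : config -> config) (E : pred config) :
  injective g -> pr (fun s => E (g s)) = pr E.
Proof.
move=> gI; have N0 : N != 0 by rewrite gt_eqF.
by apply: (mulIf N0); rewrite !prE [RHS](reindex_inj gI).
Qed.

(** This is measurability of [f] with respect to the coordinates in [A]. *)
Definition depends_on (T : Type) (A : pred V) (f : config -> T) : Prop :=
  forall s s' : config, (forall v, A v -> s v = s' v) -> f s = f s'.

Lemma depends_onW (T : Type) (A B : pred V) (f : config -> T) :
  (forall v, A v -> B v) -> depends_on A f -> depends_on B f.
Proof. by move=> AB fA s s' H; apply: fA => v /AB; exact: H. Qed.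

Lemma depends_on_map (T U : Type) (g : T -> U) (A : pred V) (f : config -> T) :
  depends_on A f -> depends_on A (fun s => g (f s)).
Proof. by move=> fA s s' /fA ->. Qed.

Lemma depends_on_and (A : pred V) (E F : pred config) :
  depends_on A E -> depends_on A F -> depends_on A (fun s => E s && F s).
Proof. by move=> EA FA s s' H; rewrite (EA _ _ H) (FA _ _ H). Qed.

Lemma depends_on_all (I : eqType) (l : seq I) (A : pred V) (E : I -> pred config) :
  {in l, forall i, depends_on A (E i)} -> depends_on A (fun s => all (E^~ s) l).
Proof. by move=> EA s s' H; apply: eq_in_all => i il; exact: EA. Qed.

(* Exchanging two configurations outside [A] is a bijection of the pairs. *)
Lemma pr_indep (A B : pred V) (E F : pred config) :
  depends_on A E -> depends_on B F -> (forall v, A v -> ~~ B v) ->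
  pr (fun s => E s && F s) = pr E * pr F.
Proof.
move=> EA FB AB; have N0 : N != 0 by rewrite gt_eqF.
apply: (mulIf N0); apply: (mulIf N0).
have -> : pr E * pr F * N * N = (pr E * N) * (pr F * N) by ring.
rewrite !prE.
pose mix (s s' : config) : config := [ffun v => if A v then s v else s' v].
pose swap (p : config * config) := (mix p.1 p.2, mix p.2 p.1).
have swapK : involutive swap.
  move=> [s s']; congr pair; apply/ffunP => v; rewrite !ffunE /=;
  by case: (A v).
have -> : (\sum_(s : config) (E s && F s)%:R) * N
    = \sum_(p : config * config) (E p.1 && F p.1)%:R :> R.
  rewrite -(pair_bigA _ (fun s _ : config => (E s && F s)%:R)) /= mulr_suml.
  by apply: eq_bigr => s _; rewrite sumr_const mulr_natr.
rewrite (reindex_inj (inv_inj swapK)) /=.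
rewrite mulr_suml -(pair_bigA _ (fun s s' => (E (mix s s') && F (mix s s'))%:R)) /=.
apply: eq_bigr => s _; rewrite mulr_sumr; apply: eq_bigr => s' _.
have -> : E (mix s s') = E s by apply: EA => v Av; rewrite ffunE Av.
have -> : F (mix s s') = F s'.
  apply: FB => v Bv; rewrite ffunE; case: ifP => // Av.
  by have := AB v Av; rewrite Bv.
by case: (E s); case: (F s'); rewrite ?mulr1 ?mulr0.
Qed.

Lemma pr_all_indep (I : eqType) (l : seq I) (A : I -> pred V) (E : I -> pred config) :
  uniq l -> {in l, forall i, depends_on (A i) (E i)} ->
  {in l &, forall i j, forall v, A i v -> A j v -> i = j} ->
  pr (fun s => all (E^~ s) l) = \prod_(i <- l) pr (E i).
Proof.
elim: l => [|i l IH] /=; first by rewrite big_nil pr_true.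
move=> /andP[il ul] EA disj; rewrite big_cons -IH //; first last.
- by move=> j k jl kl; apply: disj; rewrite inE ?jl ?kl orbT.
- by move=> j jl; apply: EA; rewrite inE jl orbT.
apply: (pr_indep (A := A i) (B := fun v => has (A^~ v) l)).
- by apply: EA; rewrite mem_head.
- apply: depends_on_all => j jl; apply: depends_onW (EA j _); last first.
    by rewrite inE jl orbT.
  by move=> v Av; apply/hasP; exists j.
- move=> v Av; apply/hasP => -[j jl Aj]; move/negP: il; apply.
  by rewrite (disj i j _ _ v Av Aj) // ?mem_head // inE jl orbT.
Qed.

(** * Harris' inequality for increasing events *)

Definition le_config (s s' : config) : Prop := forall v, s v -> s' v.

Definition flip (v : V) (s : config) : config := [ffun u => s u (+) (u == v)].

Lemma flipK (v : V) : involutive (flip v).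
Proof.
by move=> s; apply/ffunP => u; rewrite !ffunE -addbA addbb addbF.
Qed.

Let mono (f : config -> R) := forall s s', le_config s s' -> f s <= f s'.

(** This is the conditional expectation of [f] given all coordinates except [v]. *)
Let avg (v : V) (f : config -> R) (s : config) : R := (f s + f (flip v s)) / 2.

Let avg_sum v f : \sum_s avg v f s = \sum_s f s.
Proof.
rewrite -mulr_suml big_split /=.
have -> : \sum_s f (flip v s) = \sum_s f s.
  by rewrite [RHS](reindex_inj (inv_inj (flipK v))).
lra.
Qed.

Let avg_mono v f : mono f -> mono (avg v f).
Proof.
move=> mf s s' H; rewrite /avg ler_pM2r ?invr_gt0 ?ltr0n //.
case sv : (s v); case sv' : (s' v).
- apply: lerD; apply: mf => // u; rewrite !ffunE.
  by have [->|_] := eqVneq u v; rewrite ?sv ?sv' ?addbF //; exact: H.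
- by have := H v; rewrite sv sv' => /(_ isT).
- rewrite [leRHS]addrC; apply: lerD; apply: mf => u; rewrite !ffunE;
  by have [->|_] := eqVneq u v; rewrite ?sv ?sv' ?addbF //; exact: H.
- apply: lerD; apply: mf => // u; rewrite !ffunE.
  by have [->|_] := eqVneq u v; rewrite ?sv ?sv' ?addbF //; exact: H.
Qed.

Let flip_cmp v s : le_config s (flip v s) \/ le_config (flip v s) s.
Proof.
case sv : (s v); [right|left] => u; rewrite !ffunE;
by have [->|_] := eqVneq u v; rewrite ?sv ?addbF.
Qed.

(** Chebyshev's sum inequality on two points: [s] and [flip v s] are comparable, so the increments
    of [f] and [g] between them have the same sign. *)
Let avg_prod v f g s : mono f -> mono g ->
  avg v f s * avg v g s <= avg v (fun s => f s * g s) s.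
Proof.
move=> mf mg; rewrite /avg.
have : 0 <= (f s - f (flip v s)) * (g s - g (flip v s)).
  case: (flip_cmp v s) => H.
    by apply: mulr_le0; rewrite subr_le0; [apply: mf | apply: mg].
  by apply: mulr_ge0; rewrite subr_ge0; [apply: mf | apply: mg].
nra.
Qed.

Let avgs (l : seq V) (f : config -> R) : config -> R := foldr avg f l.

Let avgs_sum l f : \sum_s avgs l f s = \sum_s f s.
Proof. by elim: l => //= v l <-; rewrite avg_sum. Qed.

Let avgs_mono l f : mono f -> mono (avgs l f).
Proof. by move=> mf; elim: l => //= v l; exact: avg_mono. Qed.

Let avgs_prod l f g s : mono f -> mono g ->
  avgs l f s * avgs l g s <= avgs l (fun s => f s * g s) s.
Proof.
move=> mf mg; elim: l s => //= v l IH s.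
apply: le_trans (avg_prod _ _ (avgs_mono _ mf) (avgs_mono _ mg)) _.
by rewrite /avg ler_pM2r ?invr_gt0 ?ltr0n // lerD.
Qed.

Let avgs_flip l f v s : v \in l -> avgs l f (flip v s) = avgs l f s.
Proof.
have flipC u w x : flip u (flip w x) = flip w (flip u x).
  by apply/ffunP => z; rewrite !ffunE -!addbA [X in _ (+) X]addbC.
elim: l s => //= u l IH s; rewrite inE /avg => /orP[/eqP ->|vl].
  by rewrite flipK addrC.
by rewrite IH // flipC IH.
Qed.

(** Each flip of an averaged coordinate leaves the average unchanged, so [s] can be turned into [s']
    one differing coordinate at a time. *)
Let avgs_const f s s' : avgs (enum V) f s = avgs (enum V) f s'.
Proof.
have [n] := ubnP #|[set v | s v != s' v]|; elim: n s => // n IH s hn.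
have [E|] := set_0Vmem [set v | s v != s' v].
  congr (avgs _ _ _); apply/ffunP => v; apply/eqP; apply: contraT => sv.
  by have := in_set0 v; rewrite -E inE sv.
move=> [v]; rewrite inE => sv.
rewrite -(@avgs_flip _ f v s) ?mem_enum //; apply: IH.
suff : #|[set u | flip v s u != s' u]|.+1 = #|[set u | s u != s' u]| by lia.
rewrite [RHS](cardsD1 v) inE sv add1n; congr _.+1; apply: eq_card => u.
rewrite !inE ffunE; have [->|_] := eqVneq u v; last by rewrite addbF.
by move: sv; case: (s v); case: (s' v).
Qed.

Definition increasing (E : pred config) : Prop :=
  forall s s', le_config s s' -> E s -> E s'.

(* Harris: averaging over one coordinate at a time preserves monotonicity, can
   only decrease the mean of the product, and ends at constant functions. *)
Lemma harris (E F : pred config) : increasing E -> increasing F ->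
  pr E * pr F <= pr (fun s => E s && F s).
Proof.
move=> iE iF.
have iR (H : pred config) : increasing H -> mono (fun s => (H s)%:R).
  move=> iH s s' /iH; case: (H s) => [/(_ isT) -> //|_].
  by rewrite ler0n.
rewrite -(ler_pM2r N_gt0) -(ler_pM2r N_gt0).
have -> : pr E * pr F * N * N = (pr E * N) * (pr F * N) by ring.
rewrite !prE.
have -> : \sum_s (E s && F s)%:R = \sum_s (E s)%:R * (F s)%:R :> R.
  by apply: eq_bigr => s _; case: (E s); rewrite ?mul1r ?mul0r.
have const f : \sum_s f s = avgs (enum V) f [ffun=> true] * N.
  rewrite -(avgs_sum (enum V)).
  under eq_bigr do rewrite (avgs_const f _ [ffun=> true]).
  by rewrite sumr_const mulr_natr.
rewrite !const.
have := avgs_prod (enum V) [ffun=> true] (iR _ iE) (iR _ iF).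
set a := avgs _ _ _; set b := avgs _ _ _; set c := avgs _ _ _ => abc.
have -> : a * N * (b * N) = a * b * (N * N) by ring.
by rewrite -[c * N * N]mulrA ler_pM2r // mulr_gt0.
Qed.

Lemma increasing_all (I : eqType) (l : seq I) (E : I -> pred config) :
  {in l, forall i, increasing (E i)} -> increasing (fun s => all (E^~ s) l).
Proof.
move=> iE s s' H /allP Es; apply/allP => i il.
exact: iE i il _ _ H (Es i il).
Qed.

Lemma harris_all (I : eqType) (l : seq I) (E : I -> pred config) :
  {in l, forall i, increasing (E i)} ->
  \prod_(i <- l) pr (E i) <= pr (fun s => all (E^~ s) l).
Proof.
elim: l => [|i l IH] iE; first by rewrite big_nil pr_true.
have iE' : {in l, forall j, increasing (E j)}.
  by move=> j jl; apply: iE; rewrite inE jl orbT.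
rewrite big_cons /=; apply: le_trans (harris _ (increasing_all iE')).
  by rewrite ler_wpM2l ?pr_ge0 // IH.
by apply: iE; rewrite mem_head.
Qed.

Lemma pr_spin (v : V) (b : bool) : pr (fun s => s v == b) = 2^-1.
Proof.
have := pr_bij (fun s : config => s v == b) (inv_inj (flipK v)).
have -> : pr (fun s => flip v s v == b) = pr (fun s => ~~ (s v == b)).
  by apply: pr_ext => s; rewrite ffunE eqxx; case: (s v); case: b.
by rewrite prC; lra.
Qed.

End UniformMeasure.

(** * Majority dynamics and the upper bound *)

Section MajorityRule.
Variable G : sgraph.
Implicit Types (f g : G -> int) (s : {ffun G -> bool}).

Definition sgn (b : bool) : int := if b then 1 else -1.

Definition signs f : Prop := forall i, exists b, f i = sgn b.

Lemma signs_spins s : signs (spins s).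
Proof. by move=> i; exists (s i). Qed.

(** Parity: the sum is twice the number of positive terms minus an odd number. *)
Lemma sum_signs_neq0 f (P : pred G) : signs f -> odd #|P| ->
  \sum_(i | P i) f i != 0.
Proof.
move=> sf oP.
have -> : \sum_(i | P i) f i = 2 * \sum_(i | P i) (f i == 1)%:Z - #|P|%:Z.
  rewrite -sum1_card mulr_sumr [in X in _ - X](big_morph Posz PoszD (erefl 0)).
  by rewrite -sumrB; apply: eq_bigr => i _; have [[] ->] := sf i.
by set X := \sum_(i | P i) _; apply/eqP; lia.
Qed.

Lemma sgz_le (a b : int) : a <= b -> Num.sg a <= Num.sg b.
Proof. by case: (sgrP a) => ha; case: (sgrP b) => hb //; lia. Qed.

Lemma majority_ext f g i : f =1 g -> majority f i = majority g i.
Proof. by move=> fg; congr Num.sg; apply: eq_bigr => j _. Qed.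

Lemma majority_le f g i : (forall j, f j <= g j) -> majority f i <= majority g i.
Proof. by move=> fg; apply: sgz_le; apply: ler_sum => j _. Qed.

Lemma majority_opp f i : majority (fun j => - f j) i = - majority f i.
Proof. by rewrite /majority sumrN sgrN. Qed.

(** Two exceptional neighbours lower the sum in direction [b] by at most 4, which a degree of at
    least 5 absorbs. The exceptions will be the parent and one child, or only the parent, with
    [p = q]. *)
Lemma majority_most f (i p q : G) b : signs f -> (5 <= degree i)%N ->
  (forall j, edge i j -> j != p -> j != q -> f j = sgn b) ->
  majority f i = sgn b.
Proof.
move=> sf di H.
have count1 (z : G) : \sum_(j | edge i j) (j == z)%:Z <= 1.
  rewrite big_mkcond (bigD1 z) //= big1 => [|j /negbTE ->]; last by case: ifP.
  by rewrite eqxx addr0; case: ifP.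
have : (degree i)%:Z - 4 <= sgn b * \sum_(j | edge i j) f j.
  apply: (@le_trans _ _ (\sum_(j | edge i j)
                          (1 - 2 * (j == p)%:Z - 2 * (j == q)%:Z))).
    have -> : (degree i)%:Z = \sum_(j | edge i j) 1.
      by rewrite /degree cardsE -sum1_card (big_morph Posz PoszD (erefl 0)).
    rewrite !sumrB -!mulr_sumr.
    move: (count1 p) (count1 q); set N := \sum_(j | _) 1.
    set P := \sum_(j | _) _; set Q := \sum_(j | _) _; clearbody N P Q; lia.
  rewrite mulr_sumr; apply: ler_sum => j ij.
  have [->|jp] := eqVneq j p; first by have [[] ->] := sf p; case: b {H}; case: (_ == q).
  have [->|jq] := eqVneq j q; first by have [[] ->] := sf q; case: b {H}.
  by rewrite H //; case: b {H}.
rewrite /majority /sgn; set S := \sum_(j | _) _; case: b {H} => /= HS.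
  by rewrite gtr0_sg //; lia.
by rewrite ltr0_sg //; lia.
Qed.

Lemma dynamicsS s t : dynamics s t.+1 = majority (dynamics s t).
Proof. by []. Qed.

Lemma periodicS s t : periodic_from s t -> periodic_from s t.+1.
Proof.
move=> /forallP H; apply/forallP => i; apply/eqP.
by apply: (majority_ext i) => j; apply/eqP; exact: H.
Qed.

Lemma stabilisation_time_le s t : periodic_from s t -> (stabilisation_time s <= t)%N.
Proof. by rewrite /stabilisation_time; case: ex_minnP => n _; exact. Qed.

(** Periodicity persists once it holds, so its failure at time [t] excludes all earlier times as
    well. *)
Lemma stabilisation_time_gt s t : ~~ periodic_from s t -> (t < stabilisation_time s)%N.
Proof.
rewrite /stabilisation_time; case: ex_minnP => n pn _; apply: contraR.
rewrite -leqNgt => /subnK <-; elim: (t - n)%N => // m; rewrite addSn.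
exact: periodicS.
Qed.

Hypothesis oddG : forall x : G, odd (degree x).

Lemma signs_majority f : signs f -> signs (majority f).
Proof.
move=> sf i; have := oddG i; rewrite /degree cardsE.
move=> /(sum_signs_neq0 (P := edge i) sf).
by rewrite /majority; case: sgrP => // _ _; [exists true | exists false].
Qed.

Lemma signs_dynamics s t : signs (dynamics s t).
Proof. by elim: t => [|t]; [exact: signs_spins | exact: signs_majority]. Qed.

Definition switch s t (b : bool) (i : G) : Prop :=
  dynamics s t i = sgn (~~ b) /\ dynamics s t.+2 i = sgn b.

Lemma not_periodic_switch s t : ~~ periodic_from s t ->
  exists i b, switch s t b i.
Proof.
move=> /forallPn[i]; have [b hb] := signs_dynamics s t.+2 i.
have [b' hb'] := signs_dynamics s t i.
rewrite hb hb' => ne; exists i, b; split => //; rewrite hb'.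
by case: b b' ne {hb hb'} => -[].
Qed.

(** Without such a neighbour, the neighbour sum of [i] would not move towards [b] between times [t]
    and [t + 2], whereas its sign does. *)
Lemma switch_neighbour s t b i : switch s t.+1 b i ->
  exists2 j, edge i j & switch s t b j.
Proof.
move=> [h1 h3].
case: (pselect (exists2 j, edge i j & switch s t b j)) => // no; exfalso.
have le j : edge i j -> sgn b * dynamics s t.+2 j <= sgn b * dynamics s t j.
  move=> ij; have [b1 e1] := signs_dynamics s t.+2 j.
  have [b0 e0] := signs_dynamics s t j.
  suff : (b1, b0) <> (b, ~~ b) by rewrite e1 e0; case: b {h1 h3 no} b0 b1 {e0 e1} => -[] [].
  by move=> [E1 E0]; apply: no; exists j => //; rewrite /switch e1 e0 E1 E0.
have : sgn b * \sum_(j | edge i j) dynamics s t.+2 j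
       <= sgn b * \sum_(j | edge i j) dynamics s t j.
  by rewrite !mulr_sumr; apply: ler_sum.
set S2 := \sum_(j | _) dynamics s t.+2 j; set S0 := \sum_(j | _) dynamics s t j.
have e1 : dynamics s t.+1 i = Num.sg S0 by [].
have e3 : dynamics s t.+3 i = Num.sg S2 by [].
move: h1 h3; rewrite e1 e3; clearbody S0 S2.
by case: b {le no} => /=; rewrite /sgn; case: (sgrP S0) => //; case: (sgrP S2) => //; lia.
Qed.

Lemma switch_alternate s t b i : switch s t b i -> ~ switch s t.+2 b i.
Proof. by move=> [_ h] [h' _]; rewrite h in h'; case: b {h} h'. Qed.

End MajorityRule.

(** * Backward propagation of switches and the upper bound *)

Section UpperBound.
Variables (k : nat) (G : sgraph) (r : G).
Hypotheses (k_ge4 : (4 <= k)%N) (k_even : ~~ odd k).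
Hypothesis perfG : perfect_kary_tree k r.
Let treeG : is_tree G. Proof. by case: perfG. Qed.
Let oddG := degree_odd perfG k_even.
Local Notation depth := (dist r).
Local Notation h := (height r).
Variable s : {ffun G -> bool}.

(* The leaves below such a vertex repeat its previous state. *)
Lemma no_switch_above_leaves t b (x : G) :
  x != r -> (depth x).+1 = h -> ~ switch s t b x.
Proof.
move=> xr hx [h0 h2]; move: h2.
rewrite (dynamicsS s t.+1) (@majority_most _ _ _ (par r x) (par r x) (~~ b)).
- by case: b {h0}.
- exact: signs_dynamics.
- by rewrite (degree_inner perfG) // -hx.
move=> y xy yp _; have [E|yx] := edge_par_child r treeG xy; first by rewrite E eqxx in yp.
have hy : depth y = h by rewrite (child_depth yx).
have yr := bottom_neq_root perfG hy.
rewrite dynamicsS /majority (sum_neighbours treeG _ yr).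
have /(childP r treeG)[-> _] := yx.
by rewrite (children_bottom hy) big_set0 addr0 h0; case: b {h0}.
Qed.

(** A leaf copies its parent one step later, so its switch at the positive time [t + 1] would be a
    switch of the parent at time [t], which is excluded. *)
Lemma switch_depth t b (x : G) : (2 <= h)%N -> switch s t.+1 b x -> (depth x + 2 <= h)%N.
Proof.
move=> h2 sx.
have hx1 : (depth x).+1 <> h.
  move=> hx; apply: (no_switch_above_leaves _ hx sx).
  by apply/eqP => E; rewrite E distxx in hx; lia.
have hx0 : depth x <> h.
  move=> hx; have xr := bottom_neq_root perfG hx.
  have [y xy sy] := switch_neighbour oddG sx.
  have [E|] := edge_par_child r treeG xy; last by rewrite children_bottom // inE.
  have [_ hp] := parP treeG xr; rewrite -E hx in hp.
  apply: (no_switch_above_leaves _ (esym hp) sy).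
  by apply/eqP => yr; rewrite yr distxx in hp; lia.
by have := depth_le_height r x; lia.
Qed.

(* A chain of switches in one direction never backtracks: it climbs towards the
   root and then descends. *)
Lemma switch_time t b (x : G) : (2 <= h)%N -> switch s t b x -> (depth x < h)%N ->
  (depth x + t + 2 <= h)%N \/
  [/\ (t + 2 <= h + depth x)%N, (0 < t)%N & switch s t.-1 b (par r x) /\ x != r].
Proof.
move=> h2; elim: t x => [|t IH] x sx hx.
  left; suff : (depth x).+1 <> h by lia.
  move=> hx'; apply: (no_switch_above_leaves _ hx' sx).
  by apply/eqP => E; rewrite E distxx in hx'; lia.
have hx2 := switch_depth h2 sx.
have [y xy sy] := switch_neighbour oddG sx.
have [hy|hy] := edge_depth r treeG xy.
  have yx : edge y x by rewrite edge_sym.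
  have E := par_unique treeG yx hy.
  (* If the walk had descended into [y], it would have come from [x], and [x] would make the same
     switch twice, two steps apart. *)
  have [|H|[H t0 [sp _]]] := IH y sy; [lia | left; lia|].
  case: t t0 sx sy sp {IH H} => // t _ sx sy sp.
  by exfalso; apply: (switch_alternate sp); rewrite E.
have E := par_unique treeG xy hy.
have xr : x != r by apply/eqP => xr; rewrite xr distxx in hy.
right; split=> //; last by rewrite E.
by have [|H|[H _ _]] := IH y sy; lia.
Qed.

Lemma stabilisation_time_upper : (2 <= h)%N ->
  (stabilisation_time s <= h.*2 - 3)%N.
Proof.
move=> h2; apply: stabilisation_time_le; apply: contraT.
move=> /(not_periodic_switch oddG)[x [b]].
(* The successor form gives access to [switch_depth]: the depth of [x] is at most [h - 2], so
   [switch_time] allows no time beyond [2 * h - 4]. *)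
have -> : (h.*2 - 3 = (h.*2 - 4).+1)%N by lia.
move=> sx; have hx := switch_depth h2 sx.
by have [|H|[H _ _]] := switch_time h2 sx; lia.
Qed.

End UpperBound.

(** * Slow configurations and the lower bound *)

Lemma prod_seq_ge (R : numDomainType) (I : eqType) (l : seq I) (F : I -> R) (a : R) :
  0 <= a -> {in l, forall i, a <= F i} -> a ^+ size l <= \prod_(i <- l) F i.
Proof.
move=> a0; elim: l => [|i l IH] H; first by rewrite big_nil.
rewrite big_cons exprS ler_pM ?exprn_ge0 ?H ?mem_head // IH // => j jl.
by rewrite H // inE jl orbT.
Qed.

(** * Dynamics with one vertex frozen *)

Section Pinned.
Variable G : sgraph.
Implicit Types (s : {ffun G -> bool}) (u y : G) (b : bool).

(** Holding [u] at sign [b] cuts the subtree below [u] off from the rest of the tree, while the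
    dynamics stays monotone in [s] and in [b]. *)
Fixpoint pinned u b s (t : nat) : G -> int := fun y =>
  if y == u then sgn b else
  if t is t'.+1 then majority (pinned u b s t') y else spins s y.

Lemma pinned_le u b b' s s' t y : (b -> b') -> le_config s s' ->
  pinned u b s t y <= pinned u b' s' t y.
Proof.
move=> bb ss; have le_sgn (c c' : bool) : (c -> c') -> sgn c <= sgn c'.
  by case: c c' => -[] // /(_ isT).
elim: t y => [|t IH] y /=; case: eqP => _; try exact: le_sgn.
  by apply: le_sgn; exact: ss.
exact: majority_le.
Qed.

Definition negc s : {ffun G -> bool} := [ffun v => ~~ s v].

Lemma negcK : involutive negc.
Proof. by move=> s; apply/ffunP => v; rewrite !ffunE negbK. Qed.

Lemma pinned_negc u b s t y : pinned u (~~ b) (negc s) t y = - pinned u b s t y.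
Proof.
have sgnN c : sgn (~~ c) = - sgn c by case: c.
elim: t y => [|t IH] y /=; case: eqP => _ //.
  by rewrite /spins ffunE; exact: sgnN.
by rewrite -majority_opp; exact: majority_ext.
Qed.

(** A set whose only exit is [u] receives no information from outside, because the state of [u] is
    imposed. *)
Lemma pinned_local u b s s' t (T : pred G) :
  (forall y z, T y -> y != u -> edge y z -> T z) ->
  (forall y, T y -> s y = s' y) ->
  forall y, T y -> pinned u b s t y = pinned u b s' t y.
Proof.
move=> clT ss; elim: t => [|t IH] y Ty /=; case: eqVneq => // yu.
  by rewrite /spins ss.
by congr Num.sg; apply: eq_bigr => z yz; apply: IH; exact: clT yz.
Qed.

Hypothesis oddG : forall x : G, odd (degree x).

Lemma signs_pinned u b s t : signs (pinned u b s t).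
Proof.
elim: t => [|t IH] y /=; case: eqP => _; try by exists b.
  by exists (s y).
exact: signs_majority.
Qed.

(* Pinning [u] to [+1] instead of [-1] can only help, and exchanging the two
   signs exchanges the two dynamics. *)
Lemma pr_pinned (R : realType) u t y :
  2^-1 <= unif_fin_prob R (fun s : {ffun G -> bool} => pinned u true s t y == 1).
Proof.
set P := unif_fin_prob _ _.
suff : 1 - P <= P by lra.
rewrite -prC -(pr_bij _ _ (inv_inj negcK)); apply: pr_le => s.
rewrite -[true]/(~~ false) pinned_negc /= => ne.
have le : pinned u false s t y <= pinned u true s t y by exact: pinned_le.
have [[] e1] := signs_pinned u false s t y; first by move: le; rewrite e1;
  have [[] ->] := signs_pinned u true s t y.
by rewrite e1 in ne.
Qed.

End Pinned.

(** * Robust vertices, which keep their sign up to time [L] *)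

Section Trigger.
Variables (R : realType) (k : nat) (G : sgraph) (r : G).
Hypotheses (k_ge4 : (4 <= k)%N) (k_even : ~~ odd k).
Hypothesis perfG : perfect_kary_tree k r.
Let treeG : is_tree G. Proof. by case: perfG. Qed.
Let oddG := degree_odd perfG k_even.
Local Notation depth := (dist r).
Local Notation h := (height r).
Local Notation config := {ffun G -> bool}.
Local Notation pr := (@unif_fin_prob R config).
Local Notation children := (children r).

Variable L : nat.

(* The children of [u] would keep the sign [b] up to time [L] if [u] did. *)
Definition robust (u : G) (b : bool) (s : config) : bool :=
  (s u == b) && all (fun w => all (fun t => pinned u b s t w == sgn b) (iota 0 L.+1))
                    (enum (children u)).

Lemma robust_local (u : G) b : depends_on (desc r u) (robust u b).
Proof.
apply: depends_on_and; first by move=> s s' H; rewrite (H u (desc_refl r u)).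
apply: depends_on_all => w; rewrite mem_enum => wu.
apply: depends_on_all => t _ s s' ss; rewrite (pinned_local _ _ _ ss) //.
  by move=> y z dy yu yz; exact: (desc_edge treeG dy yu yz).
exact: (desc_child treeG (desc_refl r u) wu).
Qed.

Lemma robust_negc (u : G) b s : robust u (~~ b) (negc s) = robust u b s.
Proof.
rewrite /robust ffunE (inj_eq negb_inj); congr andb.
apply: eq_all => w; apply: eq_all => t; rewrite pinned_negc.
by case: b; rewrite /sgn /= ?eqr_oppLR ?opprK.
Qed.

(** By induction on time, the true dynamics coincides with the pinned one on the whole tree: the
    children of [u] have sign [b] so far, and the parent alone cannot outvote them. *)
Lemma robust_dynamics (u : G) b s t : u != r -> (depth u < h)%N -> robust u b s ->
  (t <= L)%N -> dynamics s t u = sgn b.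
Proof.
move=> ur hu /andP[/eqP su /allP Hw].
suff E : (t <= L)%N -> dynamics s t =1 pinned u b s t.
  by move=> tL; rewrite E //; case: (t) => [|?] /=; rewrite eqxx.
elim: t => [_|t IH tL] y; first by rewrite /= /spins; case: eqP => [->|//]; rewrite su.
rewrite /=; case: eqP => [->|yu].
  apply: (@majority_most _ _ _ (par r u) (par r u)).
  - exact: signs_dynamics.
  - by rewrite (degree_inner perfG hu).
  move=> w uw wp _; rewrite IH 1?ltnW //.
  have [E|wu] := edge_par_child r treeG uw; first by rewrite E eqxx in wp.
  by apply/eqP/(allP (Hw w _)); rewrite ?mem_enum // mem_iota /= add0n ltnS ltnW.
by apply: majority_ext => z; apply: IH; exact: ltnW.
Qed.

Local Notation q := (2^-1 ^+ (1 + k * L.+1) : R).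

(** Harris' inequality over one initial spin and [k] children at [L + 1] times each, every event
    having probability at least 1/2. *)
Lemma pr_robust (u : G) b : u != r -> (depth u < h)%N -> q <= pr (robust u b).
Proof.
(* The global sign change reduces to [b = true], for which all these events are increasing. *)
move=> ur hu; wlog -> : b / b = true.
  move=> H; case: b; first exact: H.
  rewrite -(pr_bij _ (robust u false) (inv_inj (@negcK G))).
  rewrite (_ : pr _ = pr (robust u true)); first exact: H.
  by apply: pr_ext => s; rewrite -(robust_negc u true).
have half : 0 <= 2^-1 :> R by rewrite invr_ge0 ler0n.
have inc w t : increasing (fun s : config => pinned u true s t w == sgn true).
  move=> s s' ss /eqP e.
  have [[] E] := signs_pinned oddG u true s' t w; first by rewrite E.
  by have := pinned_le u t w (@id true) ss; rewrite e E.
rewrite exprD expr1; apply: le_trans (harris R _ _); last 2 first.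
- by move=> s s' ss /eqP su; rewrite eqb_id; apply: ss; rewrite su.
- by apply: increasing_all => w _; apply: increasing_all => t _; exact: inc.
rewrite pr_spin ler_wpM2l //.
apply: le_trans (harris_all R _); last first.
  by move=> w _; apply: increasing_all => t _; exact: inc.
rewrite -(card_children perfG ur hu) cardE mulnC exprM.
apply: prod_seq_ge => [|w _]; first exact: exprn_ge0.
apply: le_trans (harris_all R _) => [|t _]; last exact: inc.
rewrite -[X in _ ^+ X](size_iota 0); apply: prod_seq_ge => // t _.
exact: pr_pinned.
Qed.

(** * Events that drive a positive front down a path of heirs *)

(** An arbitrary child, the next vertex of the path; a childless vertex is its own heir. *)
Definition heir (x : G) : G := odflt x [pick y in children x].

Lemma heir_child (x : G) : (depth x < h)%N -> heir x \in children x.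
Proof.
move=> hx; rewrite /heir; case: pickP => //= no.
by have := card_children_ge perfG hx; rewrite (eq_card0 no); lia.
Qed.

(** These siblings of the heir are to be positive and the other [k / 2 - 1] negative, for a total of
    1. *)
Definition promoted (x : G) : {set G} :=
  [set y in take k./2 (enum (children x :\ heir x))].

Lemma promoted_sub (x : G) : {subset promoted x <= children x :\ heir x}.
Proof. by move=> y; rewrite inE => /mem_take; rewrite mem_enum. Qed.

Lemma card_siblings (x : G) : x != r -> (depth x < h)%N ->
  #|children x :\ heir x| = k.-1.
Proof.
move=> xr hx; have := cardsD1 (heir x) (children x).
by rewrite heir_child // (card_children perfG) // add1n => ->.
Qed.

Lemma card_promoted (x : G) : x != r -> (depth x < h)%N -> #|promoted x| = k./2.
Proof.
move=> xr hx; rewrite cardsE.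
have /card_uniqP -> : uniq (take k./2 (enum (children x :\ heir x))).
  by rewrite take_uniq // enum_uniq.
by rewrite size_take -cardE card_siblings //; case: ifP => //; lia.
Qed.

(** One vertex of the path: [sg] prescribes the signs of its robust off-path children, and [E] is
    the event carried on by the heir. *)
Definition node (b : bool) (sg : pred G) (x : G) (E : pred config) (s : config) : bool :=
  (s x == b) &&
  all (fun u => if u == heir x then E s else robust u (sg u) s) (enum (children x)).

Lemma node_member_local (sg : pred G) (x : G) (E : pred config) u :
  depends_on (desc r (heir x)) E ->
  depends_on (desc r u) (fun s => if u == heir x then E s else robust u (sg u) s).
Proof.
by move=> EA; case: eqP => [->|_]; [exact: EA | exact: robust_local].
Qed.

Lemma node_local b sg (x : G) E : depends_on (desc r (heir x)) E ->
  depends_on (desc r x) (node b sg x E).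
Proof.
move=> EA; apply: depends_on_and.
  by move=> s s' H; rewrite (H x (desc_refl r x)).
apply: depends_on_all => u; rewrite mem_enum => ux.
apply: depends_onW (@node_member_local sg x E u EA) => v.
exact: desc_trans (desc_child treeG (desc_refl r x) ux).
Qed.

(** The spin of [x] and the events at its children read disjoint sets of coordinates. The prescribed
    signs may be mixed, so independence is used here instead of monotonicity. *)
Lemma pr_node b sg (x : G) E : x != r -> ((depth x).+1 < h)%N ->
  depends_on (desc r (heir x)) E ->
  2^-1 * q ^+ k.-1 * pr E <= pr (node b sg x E).
Proof.
move=> xr hx EA; have hx' := ltnW hx.
have half : 0 <= 2^-1 :> R by rewrite invr_ge0 ler0n.
rewrite /node (pr_indep R (A := pred1 x) (B := fun v => desc r x v && (v != x))); first last.
- by move=> v /= /eqP ->; rewrite eqxx andbF.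
- apply: depends_on_all => u; rewrite mem_enum => ux.
  apply: depends_onW (@node_member_local sg x E u EA) => v uv.
  rewrite (desc_trans (desc_child treeG (desc_refl r x) ux) uv) /=.
  apply/eqP => vx; move: uv; rewrite vx => /andP[+ _].
  by rewrite (child_depth ux) ltnn.
- by move=> s s' H; rewrite (H x) //=.
rewrite pr_spin -mulrA ler_wpM2l //.
rewrite (pr_all_indep R (A := desc r)); first last.
- move=> u v; rewrite !mem_enum => ux vx w; apply: desc_disjoint.
  by rewrite (child_depth ux) (child_depth vx).
- by move=> u _; exact: node_member_local.
- exact: enum_uniq.
rewrite big_enum /= (bigD1 (heir x)) ?heir_child //= eqxx mulrC ler_wpM2l ?pr_ge0 //.
rewrite -(card_siblings xr hx') -prodr_const.
rewrite (eq_bigl (fun u => (u \in children x) && (u != heir x))); last first.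
  by move=> u; rewrite !inE andbC.
apply: ler_prod => u /andP[ux /negbTE ->].
rewrite exprn_ge0 //= pr_robust //; last by rewrite (child_depth ux).
by have /(childP r treeG)[_] := ux.
Qed.

(** [n] balanced negative vertices, closed by a robust negative one. *)
Fixpoint chain (n : nat) (x : G) : pred config :=
  if n is n'.+1 then node false (mem (promoted x)) x (chain n' (heir x))
  else robust x false.

Lemma heir_neq_root (x : G) : (depth x < h)%N -> heir x != r.
Proof. by move=> /heir_child /(childP r treeG)[]. Qed.

Lemma heir_depth (x : G) : (depth x < h)%N -> depth (heir x) = (depth x).+1.
Proof. by move=> /heir_child /child_depth. Qed.

Lemma chain_local n x : depends_on (desc r x) (chain n x).
Proof.
by elim: n x => [|n IH] x; [exact: robust_local | exact: node_local].
Qed.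

Lemma pr_chain n (x : G) : x != r -> (depth x + n < h)%N ->
  (2^-1 * q ^+ k.-1) ^+ n * q <= pr (chain n x).
Proof.
have half : 0 <= 2^-1 :> R by rewrite invr_ge0 ler0n.
elim: n x => [|n IH] x xr hx; first by rewrite mul1r pr_robust // -[depth x]addn0.
have hx1 : ((depth x).+1 < h)%N by lia.
apply: le_trans (pr_node false (mem (promoted x)) xr hx1 (@chain_local n (heir x))).
rewrite exprS -mulrA ler_wpM2l ?mulr_ge0 ?exprn_ge0 //.
apply: IH; first by apply: heir_neq_root; exact: ltnW.
by rewrite heir_depth; lia.
Qed.

(** All off-path children of [x] are robustly positive, so [x] stays positive whatever its parent
    and heir do. The robust end of the chain is the [L]-th vertex below [x]. *)
Definition trigger (x : G) : pred config :=
  node true predT x (chain L.-1 (heir x)).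

Lemma trigger_local (x : G) : depends_on (desc r x) (trigger x).
Proof. by apply: node_local; exact: chain_local. Qed.

Lemma pr_trigger (x : G) : (0 < L)%N -> x != r -> (depth x + L < h)%N ->
  2^-1 ^+ (4 * k ^ 2 * L ^ 2) <= pr (trigger x).
Proof.
move=> L0 xr hx.
have half : 0 <= 2^-1 :> R by rewrite invr_ge0 ler0n.
have hx1 : ((depth x).+1 < h)%N by lia.
apply: le_trans (pr_node true predT xr hx1 (@chain_local L.-1 (heir x))).
apply: (@le_trans _ _ (2^-1 * q ^+ k.-1 * ((2^-1 * q ^+ k.-1) ^+ L.-1 * q))); last first.
  rewrite ler_wpM2l ?mulr_ge0 ?exprn_ge0 // pr_chain //.
    by apply: heir_neq_root; exact: ltnW.
  by rewrite heir_depth; lia.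
rewrite mulrA -exprS prednK // exprMn -!exprM -!exprD.
(* The exponent is [L * (1 + (1 + k * (L + 1)) * (k - 1)) + 1 + k * (L + 1)]. *)
rewrite ler_wiXn2l ?invf_le1 ?ltr0n ?ler1n //.
case: L L0 k k_ge4 => // l _ [//|m] _ /=; nia.
Qed.

Lemma chain_unfold n (x : G) s : (depth x + n <= h)%N -> chain n x s ->
  (forall i, (i < n)%N -> s (iter i heir x) = false /\
     forall u, u \in children (iter i heir x) -> u != iter i.+1 heir x ->
       robust u (u \in promoted (iter i heir x)) s) /\
  robust (iter n heir x) false s.
Proof.
elim: n x => [|n IH] x hx //= /andP[/eqP sx /allP H].
have hx1 : (depth x < h)%N by lia.
have := H (heir x); rewrite mem_enum heir_child // eqxx => /(_ isT) /IH[|H1 H2].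
  by rewrite heir_depth; lia.
split; last by rewrite -iterS iterSr.
case=> [_|i hi]; last by rewrite !iterSr; exact: H1.
split=> // u ux /negbTE /= une.
by have := H u; rewrite mem_enum ux une => /(_ isT).
Qed.

Lemma iter_heir_depth (x : G) i : (depth x + i <= h)%N ->
  depth (iter i heir x) = (depth x + i)%N.
Proof.
elim: i => [|i IH] hx; first by rewrite addn0.
by rewrite /= heir_depth IH; lia.
Qed.

Lemma iter_heir_neq_root (x : G) i : x != r -> (depth x + i <= h)%N ->
  iter i heir x != r.
Proof.
by case: i => //= i _ hx; apply: heir_neq_root; rewrite iter_heir_depth; lia.
Qed.

(* Among the [k - 1] children other than the heir, [k / 2] are positive. *)
Lemma majority_balanced (f : G -> int) (x : G) : x != r -> (depth x < h)%N ->
  (forall u, u \in children x -> u != heir x -> f u = sgn (u \in promoted x)) ->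
  majority f x = Num.sg (f (par r x) + f (heir x) + 1).
Proof.
move=> xr hx H; rewrite /majority (sum_neighbours treeG _ xr) -addrA; congr (Num.sg (_ + _)).
rewrite (bigD1 (heir x)) ?heir_child //=; congr (_ + _).
rewrite (eq_bigl [in children x :\ heir x]); last by move=> u; rewrite !inE andbC.
rewrite (eq_bigr (fun u => 2 * (u \in promoted x)%:Z - 1)); last first.
  by move=> u; rewrite in_setD1 => /andP[une ux]; rewrite H //; case: (u \in promoted x).
rewrite sumrB -mulr_sumr sumr_const card_siblings //.
have -> : \sum_(u in children x :\ heir x) (u \in promoted x)%:Z = (k./2)%:Z.
  rewrite -(card_promoted xr hx) -sum1_card (big_morph Posz PoszD (erefl 0)).
  rewrite [RHS]big_mkcond [LHS]big_mkcond; apply: eq_bigr => u _.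
  by case: ifP => pu; case: ifP => // /promoted_sub; rewrite pu.
rewrite -mulr_natr; lia.
Qed.

(** Robustness fixes both ends of the path. In between, a balanced vertex turns negative only if
    both its path neighbours are negative; as the positive vertices form an initial segment, it
    copies its predecessor. *)
Lemma trigger_front (x : G) s t i : x != r -> (depth x + L < h)%N -> trigger x s ->
  (t < L)%N -> (i <= L)%N -> dynamics s t (iter i heir x) = sgn (i <= t)%N.
Proof.
move=> xr hx /andP[/eqP sx /allP H] tL.
have hx1 : (depth x < h)%N by lia.
have hheir : (depth (heir x) + L.-1 <= h)%N by rewrite heir_depth; lia.
have := H (heir x); rewrite mem_enum heir_child // eqxx => /(_ isT).
case/(chain_unfold hheir) => mid; rewrite -iterSr prednK; last by lia.
move=> bot; elim: t i tL => [|t IH] i tL iL.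
  case: i iL => [|i] iL; first by rewrite /= /dynamics /= /spins sx.
  rewrite iterSr; have [iL'|iL'] := ltnP i L.-1.
    by have [si _] := mid i iL'; rewrite /dynamics /= /spins si.
  have -> : i = L.-1 by lia.
  have /andP[/eqP sL _] := bot.
  by rewrite -iterSr prednK // leqNgt tL /dynamics /= /spins sL.
have hi : (depth x + i <= h)%N by lia.
have vr := iter_heir_neq_root xr hi.
have [->|iL'] := eqVneq i L.
  have -> : (L <= t.+1)%N = false by lia.
  apply: (robust_dynamics _ _ bot); last by lia.
    by apply: iter_heir_neq_root; lia.
  by rewrite iter_heir_depth; lia.
case: i iL iL' hi vr => [|i] iL iL' hi vr.
  apply: (@majority_most _ _ _ (par r x) (heir x)).
  - exact: signs_dynamics.
  - by rewrite (degree_inner perfG).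
  move=> u xu up uh; have [E|ux] := edge_par_child r treeG xu.
    by rewrite E eqxx in up.
  have := H u; rewrite mem_enum ux (negbTE uh) => /(_ isT) ru.
  apply: (robust_dynamics _ _ ru); last by lia.
    by have /(childP r treeG)[] := ux.
  by rewrite (child_depth ux) /=; lia.
have iL1 : (i < L.-1)%N by lia.
have [_ sib] := mid i iL1.
rewrite dynamicsS majority_balanced //.
- have -> : par r (iter i.+1 heir x) = iter i heir x.
    have /heir_child/(childP r treeG)[] // : (depth (iter i heir x) < h)%N.
    by rewrite iter_heir_depth; lia.
  rewrite -[heir (iter _ _ _)]/(iter i.+2 heir x) !IH; try lia.
  by rewrite /sgn ltnS; case: leqP => it; case: leqP => // it'; lia.
- by rewrite iter_heir_depth; lia.
move=> u; rewrite !iterSr -[heir (iter _ _ _)]/(iter i.+1 heir (heir x)) => ux une.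
apply: (robust_dynamics _ _ (sib u ux une)); last by lia.
  by have /(childP r treeG)[] := ux.
by rewrite (child_depth ux) -iterSr iter_heir_depth; lia.
Qed.

Lemma trigger_stabilisation (x : G) s : x != r -> (depth x + L < h)%N -> (3 <= L)%N ->
  trigger x s -> (L - 3 < stabilisation_time s)%N.
Proof.
move=> xr hx L3 Tx; apply: stabilisation_time_gt; apply/forallPn.
(* Vertex [L - 2] of the path is negative at time [L - 3] and positive at time [L - 1], the last
   time covered by [trigger_front]. *)
exists (iter (L - 3).+1 heir x).
rewrite !(trigger_front xr hx Tx); try lia.
by rewrite ltnn ltnW.
Qed.

Lemma pr_no_trigger (d : nat) : (0 < L)%N -> (0 < d)%N -> (d + L < h)%N ->
  pr (fun s => ~~ has (fun x => trigger x s) (enum [set x : G | depth x == d]))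
  <= (1 - 2^-1 ^+ (4 * k ^ 2 * L ^ 2)) ^+ (k ^ d).
Proof.
move=> L0 d0 dL; set p := 2^-1 ^+ _; set l := enum _.
have depth_l x : x \in l -> depth x = d by rewrite mem_enum inE => /eqP.
rewrite (pr_ext R (F := fun s => all (fun x => ~~ trigger x s) l)); last first.
  by move=> s; rewrite -all_predC.
rewrite (pr_all_indep R (A := desc r)); first last.
- by move=> x y xl yl z; apply: desc_disjoint; rewrite !depth_l.
- by move=> x _; apply: (depends_on_map negb); exact: trigger_local.
- exact: enum_uniq.
have p01 : 0 <= p <= 1.
  by rewrite exprn_ge0 ?exprn_ile1 ?invf_le1 ?invr_ge0 ?ltr0n ?ler0n ?ler1n.
apply: (@le_trans _ _ (\prod_(x <- l) (1 - p))).
  rewrite !big_seq; apply: ler_prod => x xl; rewrite pr_ge0 /= prC lerD2l lerN2.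
  apply: pr_trigger => //; last by rewrite depth_l.
  by apply/eqP => E; have := depth_l _ xl; rewrite E distxx; lia.
rewrite big_const_seq count_predT iter_mulr_1 -cardE.
apply: ler_wiXn2l; [lra | lra |].
by apply: card_level perfG _ _; lia.
Qed.

End Trigger.

(** * Numerical estimates *)

(** Induction by [(1 - p) * (1 + (n + 1) * p) <= 1 + n * p]. The power is thus small as soon as
    [n * p] is large. *)
Lemma expr_one_minus_le (R : realType) (p : R) (n : nat) : 0 <= p <= 1 ->
  (1 - p) ^+ n * (1 + n%:R * p) <= 1.
Proof.
move=> p01; elim: n => [|n IH]; first by rewrite expr0 mul0r addr0 mulr1.
apply: le_trans IH; rewrite exprSr -mulrA ler_wpM2l ?exprn_ge0 //; first by lra.
have n0 : 0 <= n%:R :> R by rewrite ler0n.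
rewrite -natr1; nra.
Qed.

(** With [L = l + 3] and starting depth [h - (l + 4)], the number of starting vertices times the
    lower bound for the trigger probability exceeds [eps^-1]. *)
Lemma location_count (R : realType) (k h l : nat) (eps : R) :
  (4 <= k)%N -> 0 < eps -> (22 <= h)%N ->
  288 * k%:R ^+ 2 + 4 * eps^-1 <= h%:R ->
  128 * (k%:R * l%:R) ^+ 2 <= h%:R * ln k%:R :> R ->
  (l + 5 < h)%N /\
  eps^-1 * 2 ^+ (4 * k ^ 2 * (l + 3) ^ 2) < k%:R ^+ (h - (l + 4)).
Proof.
move=> k4 eps0 h22 heps hl.
have kR : 4 <= k%:R :> R by rewrite ler_nat.
have hR : 22 <= h%:R :> R by rewrite ler_nat.
have lR : 0 <= l%:R :> R by rewrite ler0n.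
have k0 : k%:R \is @Num.pos R by rewrite posrE; lra.
have lnk_le : ln k%:R <= k%:R :> R.
  by have := expR_ge1Dx (ln k%:R : R); rewrite lnK //; lra.
have lnk_ge : 3 / 4 <= ln k%:R :> R.
  have := expR_ge1Dx (- ln k%:R : R); rewrite expRN lnK //.
  have : k%:R^-1 <= 4^-1 :> R by rewrite lef_pV2 // posrE ltr0n.
  by lra.
(* Otherwise [128 * (k * l) ^ 2] would exceed [h * k], hence [h * ln k]. *)
have lh : (4 * l <= h)%N.
  rewrite leqNgt; apply/negP => lh.
  have {}lh : h%:R < 4 * l%:R :> R by rewrite -natrM ltr_nat.
  have hk : h%:R * ln k%:R <= h%:R * k%:R :> R by rewrite ler_wpM2l // ler0n.
  have : 0 < k%:R * (128 * (k%:R * l%:R) * l%:R - h%:R) :> R.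
    apply: mulr_gt0; first by lra.
    have : 4 * l%:R <= k%:R * l%:R :> R by rewrite ler_wpM2r.
    by move: lh hR; clear; nra.
  by move: hl hk; clear; nra.
split; first by move: lh h22; clear; lia.
have dR : 3 / 4 * h%:R - 4 <= (h - (l + 4))%:R :> R.
  rewrite natrB ?natrD; last by move: lh h22; clear; lia.
  have : 4 * l%:R <= h%:R :> R by rewrite -natrM ler_nat.
  by lra.
have mR : (4 * k ^ 2 * (l + 3) ^ 2)%:R <= h%:R * ln k%:R / 16 + 72 * k%:R ^+ 2 :> R.
  rewrite natrM natrM !natrX natrD.
  have : (l%:R + 3) ^+ 2 <= 2 * l%:R ^+ 2 + 18 :> R.
    by have := sqr_ge0 (l%:R - 3 : R); nra.
  move=> /(ler_wpM2l (sqr_ge0 (k%:R : R))).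
  by move: hl; rewrite exprMn; clear; nra.
have -> : k%:R ^+ (h - (l + 4)) = expR ((h - (l + 4))%:R * ln k%:R) :> R.
  by rewrite expRM_natl lnK.
(* Bounding [eps^-1] by its exponential and 2 by [expR 1] leaves a comparison of exponents. *)
apply: (@lt_le_trans _ _ (expR eps^-1 * expR (4 * k ^ 2 * (l + 3) ^ 2)%:R)).
  apply: (@lt_le_trans _ _ (expR eps^-1 * 2 ^+ (4 * k ^ 2 * (l + 3) ^ 2))).
    rewrite ltr_pM2r ?exprn_gt0 ?ltr0n //.
    by have := expR_ge1Dx (eps^-1); lra.
  rewrite ler_pM2l ?expR_gt0 // -[X in expR X]mulr1 expRM_natl.
  rewrite lerXn2r ?nnegrE ?ler0n ?expR_ge0 //.
  by have := expR_ge1Dx (1 : R); lra.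
rewrite -expRD ler_expR.
apply: (@le_trans _ _ ((3 / 4 * h%:R - 4) * ln k%:R)); last first.
  by rewrite ler_wpM2r //; lra.
apply: le_trans (lerD (lexx _) mR) _.
(* The factor 11/16 is 3/4 - 1/16. The remaining terms [eps^-1 + 72 * k ^ 2] are at most [h / 4] by
   hypothesis. *)
have : (11 / 16 * h%:R - 4) * (3 / 4) <= (11 / 16 * h%:R - 4) * ln k%:R :> R.
  by rewrite ler_wpM2l //; lra.
by lra.
Qed.

(** * Choice of the constants and combination of both bounds *)

Theorem theorem3 (R : realType) :
  exists2 c : R, 0 < c &
    forall k : nat, (4 <= k)%N -> ~~ odd k ->
    forall eps : R, 0 < eps ->
    exists D0 : nat, forall (T : sgraph) (r : T),
      perfect_kary_tree k r -> (D0 <= diameter T)%N ->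
      `| unif_fin_prob R
           (fun xi0 : {ffun T -> bool} =>
              (c * (Num.sqrt (ln k%:R) / k%:R) * Num.sqrt (diameter T)%:R
                 < (stabilisation_time xi0)%:R)
              && ((stabilisation_time xi0)%:R <= (diameter T)%:R - 3 :> R))
         - 1 | < eps.
Proof.
(* With diameter [2 * h], this constant makes the lower bound [A] satisfy
   [128 * (k * A) ^ 2 = h * ln k]. *)
exists (16^-1); first by rewrite invr_gt0 ltr0n.
move=> k k4 ek eps eps0.
have [n0 n0P] : exists n : nat, 288 * k%:R ^+ 2 + 4 * eps^-1 <= n%:R.
  by eexists; exact/ltW/truncnS_gt.
(* As the diameter is [2 * h], this gives both [22 <= h] and [n0 <= h]. *)
exists (44 + 2 * n0)%N => T r perfT hD.
have DE := diameterE (leq_trans (isT : 2 <= 4)%N k4) perfT.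
set h := height r in DE.
have k0 : 0 < k%:R :> R by rewrite ltr0n; lia.
have lnk : 0 <= ln k%:R :> R by rewrite ln_ge0 // ler1n; lia.
set A : R := _ * _ * _.
have A0 : 0 <= A by rewrite !mulr_ge0 ?divr_ge0 ?sqrtr_ge0 ?invr_ge0 ?ler0n.
have A2 : 128 * (k%:R * A) ^+ 2 = h%:R * ln k%:R.
  rewrite /A !exprMn exprVn !sqr_sqrtr ?ler0n // DE -muln2 natrM.
  by field; rewrite gt_eqF.
(* With [l] the integer part of [A], a trigger of length [l + 3] forces a stabilisation time of at
   least [l + 1], which is larger than [A]. *)
have /andP[lA Al] := truncn_itv A0; set l := Num.trunc A in lA Al.
have h22 : (22 <= h)%N by move: hD; rewrite DE; clear; lia.
have h2 : (2 <= h)%N by exact: leq_trans h22.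
have heps : 288 * k%:R ^+ 2 + 4 * eps^-1 <= h%:R :> R.
  by apply: le_trans n0P _; rewrite ler_nat; move: hD; rewrite DE; clear; lia.
have hl : 128 * (k%:R * l%:R) ^+ 2 <= h%:R * ln k%:R :> R.
  rewrite -A2 ler_pM2l ?ltr0n // lerXn2r ?nnegrE ?mulr_ge0 ?ler0n //.
  by rewrite ler_pM2l.
have [lh count] := location_count k4 eps0 h22 heps hl.
(* This is the deepest level, so the most populous one, below which a path of length [l + 3] still
   ends above the leaves. *)
have [d0 dL] : (0 < h - (l + 4))%N /\ (h - (l + 4) + (l + 3) < h)%N.
  by split; move: lh; clear; lia.
set S := (X in unif_fin_prob R X).
have S_trigger (s : {ffun T -> bool}) :
    has (fun x => trigger k r (l + 3) x s)
        (enum [set x : T | dist r x == (h - (l + 4))%N]) -> S s.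
  case/hasP => x; rewrite mem_enum inE => /eqP dx tx; apply/andP; split.
    apply: lt_le_trans Al _; rewrite ler_nat.
    have := trigger_stabilisation k4 ek perfT _ _ _ tx.
    rewrite addnK dx; apply=> //; last by rewrite leq_addl.
    by apply/eqP => E; move: d0; rewrite -dx E distxx.
  have := stabilisation_time_upper k4 ek perfT s h2.
  rewrite DE -(ler_nat R) natrB; last by move: h2; clear; lia.
  exact.
rewrite distrC ger0_norm; last first.
  by rewrite subr_ge0 -(pr_true R T); exact: pr_le.
rewrite -prC; apply: le_lt_trans (pr_le R (fun s => contra (S_trigger s))) _.
apply: le_lt_trans (pr_no_trigger R k4 ek perfT _ d0 dL) _; first by rewrite addn3.
set m := (4 * _ * _)%N in count *; set N := (k ^ _)%N.
have p01 : 0 <= (2^-1 ^+ m : R) <= 1.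
  by rewrite exprn_ge0 ?exprn_ile1 ?invf_le1 ?invr_ge0 ?ltr0n ?ler0n ?ler1n.
have Np : eps^-1 < N%:R * 2^-1 ^+ m.
  by rewrite exprVn ltr_pdivlMr ?exprn_gt0 ?ltr0n // /N natrX.
have := expr_one_minus_le N p01.
move: Np; rewrite -(ltr_pM2l eps0) mulfV ?lt0r_neq0 //.
have x0 : 0 <= N%:R * (2^-1 ^+ m : R) by rewrite mulr_ge0 ?ler0n //; case/andP: p01.
move: x0 eps0; set x := N%:R * _; set P := _ ^+ N; clearbody x P; clear.
move=> x0 eps0 ex Px; rewrite ltNge; apply/negP => epsP.
have : eps * (1 + x) <= P * (1 + x) by rewrite ler_wpM2r // addr_ge0.
by lra.
Qed.
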